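(* Let $v\ge 2$ and $w\ge2$ be integers. An optimistic $LSSD(v,k,\lambda;w)$ with $|v-2k|=2\sqrt{k-\lambda}$ exists (for some $k,\lambda$) if and only if there exists a set of $w-1$ regular unbiased Hadamard matrices with side length $v$.
   Context: A symmetric $(v,k,\lambda)$-design, $0<k<v$, consists of a set of $v$ points and a collection of $v$ blocks such that every block contains $k$ points, every point lies in $k$ blocks, every pair of distinct points lies in exactly $\lambda$ common blocks, and every pair of distinct blocks meets in exactly $\lambda$ points. Its incidence graph is the bipartite graph on points and blocks with a point adjacent to a block iff the point is in the block. A linked system of symmetric designs $LSSD(v,k,\lambda;w)$, $w\ge 2$, is a graph $\Gamma$ on $wv$ vertices whose vertex set is partitioned into $w$ sets (''fibers'') $X_1,\dots,X_w$ of size $v$ such that: (i) no edge has both ends in the same fiber; (ii) for all $i\ne j$, the subgraph of $\Gamma$ induced between $X_i$ and $X_j$ is the incidence graph of some symmetric $(v,k,\lambda)$-design; (iii) there are constants $\mu,\nu$ such that for all distinct $h,i,j$ and all $a\in X_i$, $b\in X_j$, the number of common neighbours of $a$ and $b$ lying in $X_h$ is $\mu$ if $a\sim b$ and $\nu$ if $a\not\sim b$. For $w\ge3$, $\Gamma$ is optimistic if $(2k-v)(\mu-\nu)>0$; by convention one works with the $\mu$-heavy one ($\mu>\nu$) among $\Gamma$ and its multipartite complement (swap adjacency and non-adjacency between distinct fibers), so that optimistic means $\mu>\nu$ and $2k>v$. For $w=2$ (where $\mu,\nu$ play no role) optimistic simply means $2k>v$. A real Hadamard matrix of side length $v$ is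 a $v\times v$ matrix $H$ with entries $\pm1$ and $HH^T=vI$. It is regular if $HJ=cJ$ for some constant $c$, where $J$ is the all-ones matrix. Two Hadamard matrices $H_1,H_2$ of side length $v$ are unbiased if $\frac{1}{\sqrt v}H_1H_2^T$ is a Hadamard matrix; a set of Hadamard matrices is unbiased if every two distinct members are unbiased. *)

(* Defs.v *)
From HB Require Import structures.
From mathcomp Require Import all_boot all_order all_algebra.
From mathcomp Require Import finmap.

Set Implicit Arguments.
Unset Strict Implicit.
Unset Printing Implicit Defensive.

Import Order.TTheory GRing.Theory Num.Theory.
Local Open Scope ring_scope.

(* Points are the elements of P, blocks the elements of B, and [inc] is the
   incidence relation, read only between P and B. *)
Definition symmetric_design (T U : finType) (P : {set T}) (B : {set U})
    (v k lambda : nat) (inc : T -> U -> bool) : Prop :=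
  [/\ (0 < k < v)%N, #|P| = v & #|B| = v] /\
  [/\ {in B, forall b, #|[set p in P | inc p b]| = k},
      {in P, forall p, #|[set b in B | inc p b]| = k},
      {in P &, forall p q, p != q ->
         #|[set b in B | inc p b && inc q b]| = lambda}
    & {in B &, forall b c, b != c ->
         #|[set p in P | inc p b && inc p c]| = lambda}].

Definition simple_graph (T : finType) (e : rel T) : Prop :=
  symmetric e /\ irreflexive e.

Definition fibration (v w : nat) (T : finType) (X : 'I_w -> {set T}) : Prop :=
  [/\ forall i j, i != j -> [disjoint X i & X j],
      \bigcup_i X i = [set: T]
    & forall i, #|X i| = v].

(* For w = 2 the last condition is vacuous and mu, nu are unconstrained. *)
Definition LSSD (v k lambda w mu nu : nat) (T : finType)
    (X : 'I_w -> {set T}) (e : rel T) : Prop :=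
  [/\ (2 <= w)%N, simple_graph e, #|T| = (w * v)%N & fibration v X] /\
  [/\ forall i, {in X i &, forall a b, ~~ e a b},
      forall i j, i != j -> symmetric_design (X i) (X j) v k lambda e
    & forall h i j, h != i -> h != j -> i != j ->
        {in X i & X j, forall a b,
          #|[set c in X h | e a c && e b c]| = if e a b then mu else nu}].

(* The multipartite complement negates both mu - nu and 2k - v, so "optimistic"
   does not depend on which of the two is taken; the mu-heavy one is the chosen
   representative. *)
Definition mu_heavy (w mu nu : nat) : Prop := (3 <= w)%N -> (nu < mu)%N.

Definition optimistic (v k w mu nu : nat) : Prop :=
  if (3 <= w)%N then 0 < (2 * k%:Z - v%:Z) * (mu%:Z - nu%:Z)
  else (v < 2 * k)%N.

Definition hadamard (R : rcfType) (v : nat) (H : 'M[R]_v) : Prop :=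
  (forall i j, H i j = 1 \/ H i j = -1) /\ H *m H^T = v%:R%:M.

Definition regular (R : rcfType) (v : nat) (H : 'M[R]_v) : Prop :=
  exists c : R, H *m const_mx 1 = c *: const_mx 1 :> 'M[R]_v.

Definition unbiased (R : rcfType) (v : nat) (H1 H2 : 'M[R]_v) : Prop :=
  hadamard ((Num.sqrt (v%:R : R))^-1 *: (H1 *m H2^T)).

(* Main.v *)
Require Import Defs.
From HB Require Import structures.
From mathcomp Require Import all_boot all_order all_algebra.
From mathcomp Require Import finmap ring lra.

Set Implicit Arguments.
Unset Strict Implicit.
Unset Printing Implicit Defensive.

Import Order.TTheory GRing.Theory Num.Theory.
Local Open Scope ring_scope.

(** The proof replaces both sides by one symmetric object, a system of linked
    sign matrices.  Let [L i j] be the matrix of signs ([1] for adjacent, [-1]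
    for non-adjacent) between the fibers [i] and [j], and put [s = sqrt v].  All
    the parameters of the linked system turn out to be encoded by the identities
    [L i j J = s J], [L i j (L i j)^T = v I] and [L i h L h j = s L i j].

    From a linked system ([linked_signs_of_LSSD]): the design axioms say that
    [L = L i j] has constant row sum [t = 2k - v] and that [L L^T] is [v] on the
    diagonal and [4 lambda - 4 k + v = v - t^2] off it, the last equality being
    the hypothesis [t^2 = 4 (k - lambda)].  Summing a row of [L L^T] gives
    [t^2 = v + (v - 1)(v - t^2)], that is [t^2 = v], so [t = s] and
    [L L^T = v I].  A product [A = L i h L h j] takes one value on edges and
    another on non-edges, so [A = m J + d L i j] with [d = 2 (mu - nu) > 0].  The
    sums along a row of [A] and of the squares of its entries are [v] and [v^2];
    these two equations leave only [m = 0] and [d = s] among the positive [d].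

    Conversely ([LSSD_of_linked_signs]) the three identities count degrees and
    common neighbours, which yields [2 k = v + s], [4 lambda = v + 2 s],
    [4 mu = v + 3 s] and [4 nu = v + s].

    On the Hadamard side, fixing the fiber [0] and taking the matrices [L i 0]
    gives regular Hadamard matrices with [L i 0 (L j 0)^T = s L i j], so they are
    unbiased ([hadamards_of_linked_signs]).  For the way back
    ([linked_signs_of_hadamards]), a regular Hadamard matrix has row sum [s] or
    [-s]; negating it when needed, one gets [M 1, ..., M (w - 1)] with row sum
    [s].  Setting [M 0 = s I] and [L i j = s^-1 M i (M j)^T] treats all fibers
    alike, and each identity follows from [M h^T M h = v I]. *)

(** * Counting with signs *)

Section Signs.
Variable R : realFieldType.

Definition sign_of (b : bool) : R := if b then 1 else -1.

Lemma natr_card_set (I : finType) (P : pred I) :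
  #|[set i | P i]|%:R = \sum_i (P i)%:R :> R.
Proof. by rewrite -natr_sum -big_mkcond /= sum1dep_card. Qed.

Lemma sum_sign_of (I : finType) (P : pred I) :
  \sum_i sign_of (P i) = 2 * #|[set i | P i]|%:R - #|I|%:R.
Proof.
rewrite natr_card_set -sum1_card natr_sum mulr_sumr -sumrB.
by apply: eq_bigr => i _; rewrite /sign_of; case: (P i) => /=; ring.
Qed.

(** An inner product of sign vectors counts common [1]s: this is what turns
    statements about common neighbours into statements about matrix products. *)
Lemma sum_sign_of_mul (I : finType) (P Q : pred I) :
  \sum_i sign_of (P i) * sign_of (Q i) =
  4 * #|[set i | P i && Q i]|%:R - 2 * #|[set i | P i]|%:R
    - 2 * #|[set i | Q i]|%:R + #|I|%:R.
Proof.
rewrite !natr_card_set -sum1_card natr_sum !mulr_sumr -!sumrB -big_split.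
by apply: eq_bigr => i _; rewrite /sign_of; case: (P i); case: (Q i) => /=; ring.
Qed.

Lemma sign_of_eq1 (a : R) : a = 1 \/ a = -1 -> sign_of (a == 1) = a.
Proof.
case=> ->; rewrite /sign_of ?eqxx // ifF //.
by apply/eqP; lra.
Qed.

End Signs.

Lemma three_distinct (w : nat) (h i j : 'I_w) : h != i -> h != j -> i != j -> (3 <= w)%N.
Proof.
move=> hi hj ij.
have := max_card [set h; i; j].
rewrite card_ord setUC cardsU1 cards2 !inE hi negb_or.
by rewrite [j == h]eq_sym [j == i]eq_sym hj ij.
Qed.

(** * Orthogonal matrices with constant row sums *)

Section Matrices.
Variables (R : realFieldType) (v : nat).
Local Notation J := (const_mx 1 : 'M[R]_v).

Lemma mulmx_const1E (A : 'M[R]_v) i j : (A *m J) i j = \sum_k A i k.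
Proof. by rewrite mxE; apply: eq_bigr => k _; rewrite mxE mulr1. Qed.

Lemma mulmx_const1P (A : 'M[R]_v) (c : R) :
  (forall i, \sum_k A i k = c) -> A *m J = c *: J.
Proof. by move=> h; apply/matrixP => i j; rewrite mulmx_const1E !mxE h mulr1. Qed.

Lemma row_sum_mul (A : 'M[R]_v) (c : R) i : A *m J = c *: J -> \sum_k A i k = c.
Proof. by move=> h; rewrite -(mulmx_const1E A i i) h !mxE mulr1. Qed.

Lemma orthogonal_tr (A : 'M[R]_v) (q : R) : q != 0 -> A *m A^T = q%:M -> A^T *m A = q%:M.
Proof.
move=> q0 h.
have /mulmx1C : A *m (q^-1 *: A^T) = 1%:M by rewrite -scalemxAr h scale_scalar_mx mulVf.
rewrite -scalemxAl => h2.
by rewrite -[LHS]scale1r -(divff q0) -scalerA h2 scalemx1.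
Qed.

(** Multiplying [A J = s J] by [A^T] on the left gives [s^2 J = s (A^T J)]. *)
Lemma regular_tr (A : 'M[R]_v) (s : R) : s != 0 ->
  A *m A^T = (s ^+ 2)%:M -> A *m J = s *: J -> A^T *m J = s *: J.
Proof.
move=> s0 /orthogonal_tr; rewrite expf_neq0 // => /(_ isT) h1 h2.
apply: (scalerI s0).
by rewrite scalerA -expr2 scalemxAr -h2 mulmxA h1 mul_scalar_mx.
Qed.

(** Both [v] and [c^2] are the factor by which [A] scales the squared norm of the
    all-ones vector; here [J] stands for that vector. *)
Lemma regular_const_sqr (A : 'M[R]_v) (c : R) : (0 < v)%N ->
  A *m A^T = v%:R%:M -> A *m J = c *: J -> c ^+ 2 = v%:R.
Proof.
move=> v0 /orthogonal_tr; rewrite pnatr_eq0 -lt0n v0 => /(_ isT) h1 h2.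
have h3 : v%:R *: (J *m J) = c ^+ 2 *: (J *m J).
  have JT : J^T = J by rewrite trmx_const.
  transitivity ((A *m J)^T *m (A *m J)).
    by rewrite trmx_mul JT mulmxA -(mulmxA J) h1 mul_mx_scalar -scalemxAl.
  have -> : (A *m J)^T = c *: J by rewrite h2 linearZ /= JT.
  by rewrite h2 -scalemxAl -scalemxAr scalerA expr2.
have JJ : (J *m J) (Ordinal v0) (Ordinal v0) = v%:R.
  rewrite mulmx_const1E (eq_bigr (fun=> 1)) => [|k _]; last by rewrite mxE.
  by rewrite sumr_const card_ord.
have /matrixP/(_ (Ordinal v0) (Ordinal v0)) := h3.
by rewrite mxE [RHS]mxE JJ => /mulIf ->; rewrite // pnatr_eq0 -lt0n.
Qed.

End Matrices.

(** * Systems of linked sign matrices *)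

(** The intermediate object of the proof: [L i j] is the sign matrix between the
    fibers [i] and [j].  In its applications [s] is the square root of [v]. *)
Definition linked_signs (R : rcfType) (v w : nat) (s : R)
    (L : 'I_w -> 'I_w -> 'M[R]_v) : Prop :=
  [/\ forall i j, i != j -> forall x y, L i j x y = 1 \/ L i j x y = -1,
      forall i j, L j i = (L i j)^T,
      forall i j, i != j -> L i j *m const_mx 1 = s *: const_mx 1 :> 'M[R]_v,
      forall i j, i != j -> L i j *m L j i = v%:R%:M
    & forall i h j, i != h -> h != j -> i != j -> L i h *m L h j = s *: L i j].

(** * Linked sign matrices and unbiased regular Hadamard matrices *)

(** The fiber [0], relative to which the others are coordinatized, is given the
    matrix [s I]; then [s^-1 M i (M j)^T] is the right matrix also when [i] or
    [j] is [0]. *)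
Lemma linked_signs_of_hadamards (R : rcfType) (v n : nat) (S : {fset 'M[R]_v}) :
  (0 < v)%N -> #|` S|%fset = n ->
  (forall H, H \in S -> hadamard H /\ regular H) ->
  (forall H1 H2, H1 \in S -> H2 \in S -> H1 != H2 -> unbiased H1 H2) ->
  exists L : 'I_n.+1 -> 'I_n.+1 -> 'M[R]_v, linked_signs (Num.sqrt v%:R) L.
Proof.
move=> v0 cS hS uS; have s2 : Num.sqrt v%:R ^+ 2 = v%:R :> R by rewrite sqr_sqrtr ?ler0n.
have s0 : Num.sqrt v%:R != 0 :> R by rewrite gt_eqF ?sqrtr_gt0 ?ltr0n.
rewrite /unbiased in uS; move: (Num.sqrt v%:R) uS s2 s0 => s uS s2 s0.
pose F (i : 'I_n) : 'M[R]_v := nth 0 (enum_fset S) i.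
have FS i : F i \in S by apply: mem_nth; rewrite -cS in i *; exact: ltn_ord.
have Finj i j : i != j -> F i != F j.
  by move=> ij; rewrite /F nth_uniq ?fset_uniq //; rewrite -cS in i j ij *; exact: ltn_ord.
(* The sign that brings the row sum of a regular Hadamard matrix to s. *)
pose eps (H : 'M[R]_v) : R := if H *m const_mx 1 == s *: const_mx 1 :> 'M[R]_v then 1 else -1.
have eps2 H : eps H * eps H = 1 by rewrite /eps; case: ifP => _; ring.
pose M (i : 'I_n.+1) := if unlift ord0 i is Some j then eps (F j) *: F j else s%:M.
have MM i : M i *m (M i)^T = v%:R%:M.
  rewrite /M; case: unliftP => [j|] _.
    have [[_ h] _] := hS _ (FS j).
    by rewrite linearZ /= -scalemxAl -scalemxAr scalerA eps2 scale1r.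
  by rewrite tr_scalar_mx -scalar_mxM -expr2 s2.
have MM' i : (M i)^T *m M i = v%:R%:M by apply: orthogonal_tr; rewrite ?MM // pnatr_eq0 -lt0n.
have MJ i : M i *m const_mx 1 = s *: const_mx 1 :> 'M[R]_v.
  rewrite /M; case: unliftP => [j|] _; last by rewrite mul_scalar_mx.
  have [[_ h] [c hc]] := hS _ (FS j).
  rewrite -scalemxAl /eps; case: eqP => [->|ne]; first by rewrite scale1r.
  have := regular_const_sqr v0 h hc; rewrite -s2 => /eqP; rewrite eqf_sqr.
  case/orP => /eqP cs; first by case: ne; rewrite hc cs.
  by rewrite hc cs scalerA mulN1r opprK.
have MJ' i : (M i)^T *m const_mx 1 = s *: const_mx 1 :> 'M[R]_v.
  by apply: regular_tr => //; rewrite MM s2.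
exists (fun i j => s^-1 *: (M i *m (M j)^T)); split.
- have pm (b c : R) : b * b = 1 -> c = 1 \/ c = -1 -> b * c = 1 \/ b * c = -1.
    move=> /eqP; rewrite -expr2 sqrf_eq1 => /orP[] /eqP-> [] ->; rewrite ?mul1r ?mulN1r ?opprK; tauto.
  move=> i j; rewrite /M; case: unliftP => [i'|] ->; case: unliftP => [j'|] ->;
    rewrite ?eqxx // => ij x y.
  + have {}ij : i' != j' by apply: contraNneq ij => ->.
    have [h _] := uS _ _ (FS i') (FS j') (Finj _ _ ij).
    rewrite (_ : _ *: _ =
      (eps (F i') * eps (F j')) *: (s^-1 *: (F i' *m (F j')^T))).
      rewrite mxE.
      by apply: (pm _ _ _ (h x y)); rewrite mulrACA !eps2 mulr1.
    rewrite linearZ /= -scalemxAl -scalemxAr !scalerA.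
    by rewrite -mulrA [s^-1 * _]mulrC.
  + have [[h _] _] := hS _ (FS i').
    rewrite tr_scalar_mx mul_mx_scalar scalerA mulVf // scale1r mxE.
    exact: pm.
  + have [[h _] _] := hS _ (FS j').
    rewrite mul_scalar_mx scalerA mulVf // scale1r !mxE.
    exact: pm.
- by move=> i j; rewrite linearZ /= trmx_mul trmxK.
- move=> i j _; rewrite -scalemxAl -mulmxA MJ' -scalemxAr MJ !scalerA mulVf //.
  by rewrite mul1r.
- move=> i j _; rewrite -scalemxAl -scalemxAr mulmxA -(mulmxA (M i)) MM'.
  rewrite mul_mx_scalar -scalemxAl MM !scale_scalar_mx; congr (_%:M).
  rewrite -s2; field; exact: s0.
- move=> i h j _ _ _; rewrite -scalemxAl -scalemxAr mulmxA -(mulmxA (M i)) MM'.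
  rewrite mul_mx_scalar -scalemxAl !scalerA; congr (_ *: _).
  rewrite -s2; field; exact: s0.
Qed.

(** If two of the matrices [L i 0] and [L j 0] were equal, then [s L i j] would be
    [v I], although [L i j] has no zero entry: here [2 <= v] is essential. *)
Lemma hadamards_of_linked_signs (R : rcfType) (v n : nat)
    (L : 'I_n.+1 -> 'I_n.+1 -> 'M[R]_v) : (2 <= v)%N ->
  linked_signs (Num.sqrt v%:R) L ->
  exists S : {fset 'M[R]_v},
     [/\ #|` S|%fset = n,
         forall H, H \in S -> hadamard H /\ regular H
       & forall H1 H2, H1 \in S -> H2 \in S -> H1 != H2 -> unbiased H1 H2].
Proof.
move=> v2 [Lpm Ltr LJ LL Ll].
set s := Num.sqrt _ in LJ Ll *.
have s_gt0 : 0 < s by rewrite sqrtr_gt0 ltr0n ltnW.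
have s0 : s != 0 by rewrite gt_eqF.
pose F (i : 'I_n) := L (lift ord0 i) ord0.
have l0 i : lift ord0 i != ord0 :> 'I_n.+1 by rewrite eq_sym neq_lift.
have FF i j : i != j -> F i *m (F j)^T = s *: L (lift ord0 i) (lift ord0 j).
  by move=> ij; rewrite /F -Ltr Ll ?l0 ?neq_lift.
have Fii i : F i *m (F i)^T = v%:R%:M by rewrite -Ltr LL.
have Finj : injective F.
  move=> i j Fij; apply/eqP; apply/negPn/negP => ij.
  have := FF i j ij; rewrite -Fij Fii => /matrixP.
  pose x := Ordinal (ltnW v2); pose y := Ordinal v2.
  move=> /(_ x y); rewrite !mxE /= mulr0n => /esym/eqP.
  rewrite mulf_eq0 (negPf s0) /=.
  have ij' : lift ord0 i != lift ord0 j :> 'I_n.+1 by [].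
  by case: (Lpm _ _ ij' x y) => ->; rewrite ?oppr_eq0 oner_eq0.
exists [fset F i | i in 'I_n]%fset; split.
- by rewrite card_imfset //= -cardT card_ord.
- move=> H /imfsetP[i _ ->]; split; last by exists s; exact: LJ.
  by split=> //; exact: Lpm.
- move=> H1 H2 /imfsetP[i _ ->] /imfsetP[j _ ->] Fij.
  have ij : i != j by apply: contraNneq Fij => ->.
  have ij' : lift ord0 i != lift ord0 j :> 'I_n.+1 by [].
  rewrite /unbiased FF // scalerA mulVf // scale1r; split; first exact: Lpm.
  by rewrite -Ltr LL.
Qed.

(** * Linked sign matrices and linked systems of symmetric designs *)

(** The parameters are defined as the cardinals of particular neighbourhoods, so
    that the integrality of [(v + s) / 2], [(v + 2 s) / 4], [(v + 3 s) / 4] and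
    [(v + s) / 4] comes for free; the matrix identities show that they do not depend on the choice. *)
Lemma LSSD_of_linked_signs (R : rcfType) (v w : nat)
    (L : 'I_w -> 'I_w -> 'M[R]_v) : (2 <= v)%N -> (2 <= w)%N ->
  linked_signs (Num.sqrt v%:R) L ->
  exists (k lambda mu nu : nat) (T : finType)
          (X : 'I_w -> {set T}) (e : rel T),
     [/\ LSSD v k lambda mu nu X e,
         mu_heavy w mu nu,
         optimistic v k w mu nu
       & `|v%:R - 2 * k%:R| = 2 * Num.sqrt (k%:R - lambda%:R) :> R].
Proof.
move=> v2 w2.
have s2 : Num.sqrt v%:R ^+ 2 = v%:R :> R by rewrite sqr_sqrtr ?ler0n.
have : 0 < Num.sqrt v%:R :> R by rewrite sqrtr_gt0 ltr0n ltnW.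
move: (Num.sqrt v%:R) s2 => s s2 s_gt0 [Lpm Ltr LJ LL Ll].
have v2R : 2 <= v%:R :> R by rewrite ler_nat.
have sv : s < v%:R by rewrite -s2 in v2R *; nra.
have natI (c : R) (m n : nat) : c != 0 -> c * m%:R = c * n%:R -> m = n.
  by move=> c0 /(mulfI c0)/eqP; rewrite eqr_nat => /eqP.
pose N i j x y := L i j x y == 1.
have NC i j x y : N i j x y = N j i y x by rewrite /N [L j i]Ltr mxE.
have LN i j x y : i != j -> L i j x y = sign_of R (N i j x y).
  by move=> ij; rewrite sign_of_eq1 //; apply: Lpm.
have deg i j x : i != j -> 2 * #|[set y | N i j x y]|%:R = s + v%:R :> R.
  move=> ij; have := row_sum_mul x (LJ _ _ ij).
  under eq_bigr do rewrite LN //.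
  by rewrite sum_sign_of card_ord => <-; ring.
have codeg i h j x y : i != h -> j != h ->
    4 * #|[set z | N i h x z && N j h y z]|%:R = (L i h *m L h j) x y + 2 * s + v%:R :> R.
  move=> ih jh; rewrite mxE.
  under eq_bigr do rewrite [L h j]Ltr mxE !LN //.
  by rewrite sum_sign_of_mul card_ord !deg //; ring.
have codeg_same i h x y : i != h -> x != y ->
    4 * #|[set z | N i h x z && N i h y z]|%:R = 2 * s + v%:R :> R.
  by move=> ih xy; rewrite codeg // LL // !mxE (negPf xy) mulr0n add0r.
have codeg_diff i h j x y : i != h -> j != h -> i != j ->
    4 * #|[set z | N i h x z && N j h y z]|%:R =
    (if N i j x y then 3 * s + v%:R else s + v%:R) :> R.
  move=> ih jh ij; rewrite codeg // Ll // 1?eq_sym // mxE LN // /sign_of.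
  by case: (N i j x y); ring.
pose i0 : 'I_w := Ordinal (ltnW w2); pose i1 : 'I_w := Ordinal w2.
pose x0 : 'I_v := Ordinal (ltnW v2); pose x1 : 'I_v := Ordinal v2.
pose k := #|[set y | N i0 i1 x0 y]|.
pose l := #|[set z | N i0 i1 x0 z && N i0 i1 x1 z]|.
have kE : 2 * k%:R = s + v%:R :> R by apply: deg.
have lE : 4 * l%:R = 2 * s + v%:R :> R by apply: codeg_same.
have k_gt0 : (0 < k)%N by rewrite -(ltr_nat R); lra.
have k_ltv : (k < v)%N by rewrite -(ltr_nat R); lra.
(* With three fibers, 0 < k < v provides an edge and a non-edge between the
   fibers 0 and 1; mu and nu are the numbers of their common neighbours in the
   fiber 2. *)
have [mu [nu munu]] : exists mu nu : nat, (3 <= w)%N ->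
    4 * mu%:R = 3 * s + v%:R :> R /\ 4 * nu%:R = s + v%:R :> R.
  have [w3|_] := boolP (3 <= w)%N; last by exists 0, 0.
  pose i2 : 'I_w := Ordinal w3.
  have /card_gt0P[y] := k_gt0; rewrite inE => Ny.
  have /card_gt0P[z] : (0 < #|~: [set y | N i0 i1 x0 y]|)%N.
    by rewrite cardsCs setCK card_ord subn_gt0.
  rewrite !inE => Nz.
  exists #|[set u | N i0 i2 x0 u && N i1 i2 y u]|,
         #|[set u | N i0 i2 x0 u && N i1 i2 z u]| => _.
  by rewrite !codeg_diff // Ny (negPf Nz).
pose e : rel ('I_w * 'I_v) := fun p q => (p.1 != q.1) && N p.1 q.1 p.2 q.2.
pose X (i : 'I_w) := [set p : 'I_w * 'I_v | p.1 == i].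
have cardX i (P : pred ('I_w * 'I_v)) :
    #|[set p in X i | P p]| = #|[set y | P (i, y)]|.
  have <- : #|pair i @: [set y | P (i, y)]| = #|[set y | P (i, y)]|.
    by apply: card_imset => ? ? [].
  apply: eq_card => -[j y]; rewrite !inE /=; apply/andP/imsetP => [[/eqP-> Py]|].
    by exists y; rewrite ?inE.
  by case=> z; rewrite inE => Pz [-> ->].
have cX i : #|X i| = v.
  rewrite -[RHS]card_ord -cardsT -(cardX i xpredT).
  by apply: eq_card => p; rewrite !inE andbT.
have kE' i j x : i != j -> #|[set y | N i j x y]| = k.
  by move=> ij; apply: (natI 2); rewrite ?deg ?kE ?pnatr_eq0.
have e_sym : symmetric e by move=> p q; rewrite /e eq_sym NC.
have e_deg i j p : i != j -> p \in X i -> #|[set q in X j | e p q]| = k.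
  case: p => i' x ij; rewrite inE /= => /eqP ->; rewrite cardX.
  by under eq_finset do rewrite /e /= ij; rewrite kE'.
have e_codeg i j p q : i != j -> p \in X i -> q \in X i -> p != q ->
    #|[set r in X j | e p r && e q r]| = l.
  case: p q => [i' x] [i'' y] ij; rewrite !inE /= => /eqP -> /eqP ->.
  rewrite xpair_eqE eqxx /= cardX => xy.
  under eq_finset do rewrite /e /= ij /=.
  by apply: (natI 4); rewrite ?codeg_same ?lE ?pnatr_eq0.
exists k, l, mu, nu, ('I_w * 'I_v)%type, X, e; split.
- split; split => //.
  + by split=> // p; rewrite /e eqxx.
  + by rewrite card_prod !card_ord.
  + split=> //.
      move=> i j ij; rewrite -setI_eq0; apply/eqP/setP => p; rewrite !inE.
      by apply/andP => -[/eqP-> /eqP ji]; rewrite ji eqxx in ij.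
    apply/setP => p; rewrite inE; apply/bigcupP; exists p.1 => //; by rewrite inE.
  + by move=> i p q; rewrite !inE => /eqP pi /eqP qi; rewrite /e pi qi eqxx.
  + move=> i j ij; split; split=> //.
    * by rewrite k_gt0 k_ltv.
    * move=> q qj; under eq_finset do rewrite e_sym.
      by apply: (e_deg j); rewrite // eq_sym.
    * by move=> p; apply: (e_deg i).
    * by move=> p q; apply: (e_codeg i).
    * move=> p q pj qj pq; under eq_finset do rewrite ![e _ p]e_sym ![e _ q]e_sym.
      by apply: (e_codeg j); rewrite // eq_sym.
  + move=> h i j hi hj ij [i' x] [j' y]; rewrite !inE /= => /eqP -> /eqP ->.
    have [muE nuE] := munu (three_distinct hi hj ij).
    rewrite cardX; under eq_finset do rewrite /e /= ![_ == h]eq_sym hi hj /=.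
    apply: (natI 4); first by rewrite pnatr_eq0.
    rewrite codeg_diff // 1?eq_sym // /e /= ij /=.
    by case: (N i j x y); rewrite ?muE ?nuE.
- by move=> /munu[muE nuE]; rewrite -(ltr_nat R); lra.
- have vk : (v < 2 * k)%N by rewrite -(ltr_nat R) natrM; lra.
  rewrite /optimistic; case: ifP => // /munu[muE nuE].
  rewrite mulr_gt0 // subr_gt0 ?ltz_nat //.
  by rewrite -(ltr_nat R); lra.
- have -> : v%:R - 2 * k%:R = - s by lra.
  have -> : k%:R - l%:R = (s / 2) ^+ 2 by rewrite expr_div_n s2; lra.
  by rewrite sqrtr_sqr normrN !gtr0_norm ?divr_gt0 //; lra.
Qed.
(** The identities come from evaluating row sums of matrix products in two ways.
    The condition [nu < mu] serves twice: with the optimistic condition it gives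
    [v < 2 k] when there are three fibers, and at the end it discards the root
    [d = - s]. *)
Lemma linked_signs_of_LSSD (R : rcfType) (v k lambda w mu nu : nat)
    (T : finType) (X : 'I_w -> {set T}) (e : rel T) : (2 <= v)%N ->
  LSSD v k lambda mu nu X e -> mu_heavy w mu nu -> optimistic v k w mu nu ->
  `|v%:R - 2 * k%:R| = 2 * Num.sqrt (k%:R - lambda%:R) :> R ->
  exists L : 'I_w -> 'I_w -> 'M[R]_v, linked_signs (Num.sqrt v%:R) L.
Proof.
move=> v2 [[w2 [e_sym e_irr] _ [_ _ cX]] [_ e_design e_codeg]] mu_nu opt paramE.
have v2R : 2 <= v%:R :> R by rewrite ler_nat.
have [f [f_inj f_in f_card]] : exists f : 'I_w -> 'I_v -> T,
    [/\ forall i, injective (f i), forall i y, f i y \in X i &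
        forall i (P : pred T), #|[set c in X i | P c]| = #|[set y | P (f i y)]|].
  pose f i y := enum_val (cast_ord (esym (cX i)) y).
  have f_inj i : injective (f i) by move=> y z /enum_val_inj/cast_ord_inj.
  exists f; split=> // [i y|i P]; first exact: enum_valP.
  rewrite -(card_imset _ (f_inj i)).
  apply: eq_card => c; rewrite !inE; apply/andP/imsetP => [[cXi Pc]|[y]].
    have fc : f i (cast_ord (cX i) (enum_rank_in cXi c)) = c.
      by rewrite /f cast_ordK enum_rankK_in.
    by exists (cast_ord (cX i) (enum_rank_in cXi c)); rewrite ?inE fc.
  by rewrite inE => Py ->; split; first exact: enum_valP.
pose t : R := 2 * k%:R - v%:R.
have t_gt0 : 0 < t.
  have vk : (v < 2 * k)%N.
    move: opt mu_nu; rewrite /optimistic /mu_heavy; case: ifP => // w3 + /(_ isT) mn.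
    by rewrite pmulr_lgt0 ?subr_gt0 ?ltz_nat // -natz -natrM.
  by rewrite subr_gt0 -natrM ltr_nat.
have t2 : t ^+ 2 = 4 * (k%:R - lambda%:R).
  have tE : t = 2 * Num.sqrt (k%:R - lambda%:R).
    by rewrite -paramE distrC gtr0_norm.
  have [kl|kl] := leP 0 (k%:R - lambda%:R : R).
    by rewrite tE exprMn sqr_sqrtr //; ring.
  (* A negative k - lambda would have square root 0, against 0 < t. *)
  by move: t_gt0; rewrite tE ler0_sqrtr ?mulr0 ?ltxx // ltW.
pose L i j : 'M[R]_v := \matrix_(x, y) sign_of R (e (f i x) (f j y)).
have Ltr i j : L j i = (L i j)^T by apply/matrixP => x y; rewrite !mxE e_sym.
have deg i j x : i != j -> #|[set y | e (f i x) (f j y)]| = k.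
  by move=> ij; have [_ [_ h _ _]] := e_design _ _ ij; rewrite -f_card h.
have Lsum i j x : i != j -> \sum_y L i j x y = t.
  move=> ij; under eq_bigr do rewrite mxE.
  by rewrite sum_sign_of deg // card_ord.
have LJ i j : i != j -> L i j *m const_mx 1 = t *: const_mx 1 :> 'M[R]_v.
  by move=> ij; apply: mulmx_const1P => x; apply: Lsum.
have LLE i h j x y : i != h -> j != h -> (L i h *m L h j) x y =
    4 * #|[set c in X h | e (f i x) c && e (f j y) c]|%:R - 4 * k%:R + v%:R.
  move=> ih jh; rewrite mxE f_card.
  under eq_bigr do rewrite [L h j]Ltr !mxE.
  rewrite sum_sign_of_mul !deg // card_ord; ring.
have LLdiag i j x : i != j -> (L i j *m L j i) x x = v%:R.
  move=> ij; rewrite LLE // f_card; under eq_finset do rewrite andbb.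
  by rewrite deg //; ring.
have LLoff i j x y : i != j -> x != y -> (L i j *m L j i) x y = v%:R - t ^+ 2.
  move=> ij xy; rewrite LLE // t2.
  have [_ [_ _ h _]] := e_design _ _ ij.
  by rewrite h ?(inj_eq (f_inj i)) //; ring.
(* Count a row of L L^T in two ways: entrywise, and as t times t. *)
have tv : t ^+ 2 = v%:R.
  pose i0 : 'I_w := Ordinal (ltnW w2); pose i1 : 'I_w := Ordinal w2.
  pose x0 : 'I_v := Ordinal (ltnW v2).
  have : \sum_y (L i0 i1 *m L i1 i0) x0 y = t ^+ 2.
    apply: row_sum_mul.
    by rewrite -mulmxA LJ // -scalemxAr LJ // scalerA expr2.
  rewrite (bigD1 x0) //= LLdiag // (eq_bigr (fun=> v%:R - t ^+ 2)); last first.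
    by move=> y yx; rewrite LLoff // eq_sym.
  rewrite sumr_const cardC1 card_ord -[_ *+ v.-1]mulr_natr -subn1 natrB ?(ltnW v2) // => h.
  have : v%:R * (t ^+ 2 - v%:R) = 0 by lra.
  by move/eqP; rewrite mulf_eq0 pnatr_eq0 -leqn0 leqNgt (ltnW v2) subr_eq0 => /eqP.
have LL i j : i != j -> L i j *m L j i = v%:R%:M.
  move=> ij; apply/matrixP => x y; rewrite [RHS]mxE.
  have [->|xy] := eqVneq x y; first by rewrite LLdiag.
  by rewrite LLoff // tv subrr.
have -> : Num.sqrt v%:R = t by rewrite -tv sqrtr_sqr gtr0_norm.
exists L; split=> //.
  by move=> i j _ x y; rewrite mxE /sign_of; case: ifP; [left|right].
move=> i h j ih hj ij.
have hi : h != i by rewrite eq_sym.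
have jh : j != h by rewrite eq_sym.
have ji : j != i by rewrite eq_sym.
have mn : nu%:R < mu%:R :> R by rewrite ltr_nat; apply: mu_nu; apply: (three_distinct hi hj ij).
pose d : R := 2 * (mu%:R - nu%:R).
pose m : R := 2 * (mu%:R + nu%:R) - 4 * k%:R + v%:R.
set A := L i h *m L h j.
(* A two-valued matrix is an affine function of the sign matrix L i j. *)
have AE x y : A x y = m + d * L i j x y.
  rewrite /A LLE // (e_codeg h i j) // mxE /sign_of /m /d.
  by case: (e (f i x) (f j y)); ring.
apply/matrixP => x y; rewrite AE [RHS]mxE.
have lin : m * v%:R + d * t = v%:R.
  rewrite -[RHS]tv -(row_sum_mul (A := A) (c := t ^+ 2) x).
    under eq_bigr do rewrite AE.
    by rewrite big_split sumr_const card_ord -mulr_sumr Lsum // mulr_natr.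
  by rewrite -mulmxA LJ // -scalemxAr LJ // scalerA expr2.
have quad : (m ^+ 2 + d ^+ 2) * v%:R + 2 * m * d * t = v%:R ^+ 2.
  have <- : (A *m A^T) x x = v%:R ^+ 2.
    rewrite trmx_mul -!Ltr mulmxA -(mulmxA (L i h)) LL // mul_mx_scalar.
    by rewrite -scalemxAl LL // scale_scalar_mx !mxE eqxx mulr1n expr2.
  (* The square of m + d * l, for a sign l, is affine in l. *)
  rewrite mxE (eq_bigr (fun z => (m ^+ 2 + d ^+ 2) + 2 * m * d * L i j x z)).
    by rewrite big_split sumr_const card_ord -mulr_sumr Lsum // mulr_natr.
  move=> z _; rewrite [A^T _ _]mxE AE mxE /sign_of.
  by case: (e (f i x) (f j z)); ring.
have d_gt0 : 0 < d by rewrite /d; lra.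
have t0 : t != 0 by rewrite gt_eqF.
rewrite -tv in lin quad.
have mt : m * t = t - d by apply: (mulIf t0); lra.
have : (d ^+ 2 - t ^+ 2) * (t ^+ 2 - 1) = 0.
  (* t ^+ 2 times the equation quad, arranged so that m occurs only in m * t. *)
  have : (m * t) ^+ 2 + d ^+ 2 * t ^+ 2 + 2 * (m * t) * d = (t ^+ 2) ^+ 2.
    by rewrite -quad; ring.
  by rewrite mt => hm; lra.
have t21 : t ^+ 2 - 1 != 0 by rewrite tv; apply/eqP; lra.
move/eqP; rewrite mulf_eq0 (negPf t21) orbF subr_eq0 eqf_sqr => /orP[]/eqP dt.
  have -> : m = 0 by apply: (mulIf t0); rewrite mt dt subrr mul0r.
  by rewrite dt add0r.
by exfalso; lra.
Qed.

(** * The equivalence *)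

Theorem theorem8p5 (R : rcfType) (v w : nat) (hv : (2 <= v)%N) (hw : (2 <= w)%N) :
  (exists (k lambda mu nu : nat) (T : finType)
          (X : 'I_w -> {set T}) (e : rel T),
     [/\ LSSD v k lambda mu nu X e,
         mu_heavy w mu nu,
         optimistic v k w mu nu
       & `|v%:R - 2 * k%:R| = 2 * Num.sqrt (k%:R - lambda%:R) :> R])
  <->
  (exists S : {fset 'M[R]_v},
     [/\ #|` S|%fset = (w - 1)%N,
         forall H, H \in S -> hadamard H /\ regular H
       & forall H1 H2, H1 \in S -> H2 \in S -> H1 != H2 -> unbiased H1 H2]).
Proof.
case: w hw => // n w2; rewrite subn1 /=.
split=> [[k [l [mu [nu [T [X [e [sys heavy opt paramE]]]]]]]]|[S [cS hS uS]]].
- have [L hL] := linked_signs_of_LSSD hv sys heavy opt paramE.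
  exact: hadamards_of_linked_signs hv hL.
- have [L hL] := linked_signs_of_hadamards (ltnW hv) cS hS uS.
  exact: LSSD_of_linked_signs hv w2 hL.
Qed.
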